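(* Let $k\ge1$ and $r_{\mathrm s}>0$. Conditioned on $R_k\le r_{\mathrm s}$, the coverage probability of the $k$th nearest vehicle, $p_{\mathrm c}^k(\tau_{\mathrm c})=\mathbb P(\mathrm{SINR}_k>\tau_{\mathrm c}\mid R_k\le r_{\mathrm s})$ with $\tau_{\mathrm c}>0$, is $$p_{\mathrm c}^k(\tau_{\mathrm c})=\frac{1}{\mathbb P(R_k\le r_{\mathrm s})}\int_0^{r_{\mathrm s}}\exp\!\left(-\frac{\tau_{\mathrm c}N_0\,d(r)^{\alpha}e^{\kappa_f d(r)}}{P_{\mathrm t}G_{\mathrm c}}\right)\mathcal L_{I_k}\!\left(\frac{\tau_{\mathrm c}\,d(r)^{\alpha}e^{\kappa_f d(r)}}{P_{\mathrm t}G_{\mathrm c}}\right)f_{R_k}(r)\,dr,$$ where $d(r)=\sqrt{r^2+H^2}$, $f_{R_k}$ is the PDF of $R_k$, and $\mathcal L_{I_k}$ in the integrand is the Laplace transform of the interference $I_k$ given $R_k=r$.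
   Context: Roads: a Manhattan Poisson line process with density $\lambda_\ell>0$, i.e. horizontal lines $\{y=\rho_i\}$ and vertical lines $\{x=\rho'_j\}$, where $\{\rho_i\}$, $\{\rho'_j\}$ are independent homogeneous Poisson point processes (PPPs) of intensity $\lambda_\ell$ on $\mathbb R$. Vehicles: conditionally on the roads, each road independently carries a homogeneous one-dimensional PPP of intensity $\lambda>0$. With UAV altitude $H>0$ and $a,b>0$, the line-of-sight (LoS) probability at horizontal distance $r$ is $$p_{\mathsf L}(r,H)=\frac{1}{1+a\exp\!\left(-b\left[\frac{180}{\pi}\arctan(H/r)-a\right]\right)}$$ (with $\arctan(H/0)=\pi/2$). Each vehicle is detectable independently with probability $p_{\mathsf L}(r,H)$, $r$ its distance from the origin. The typical UAV is above the origin with boresight along the positive $x$-axis. $R_k$ is the horizontal distance from the origin to the $k$th nearest detectable vehicle among those with polar angle $|\theta|\le\gamma/2$, where $\gamma\in(0,\pi)$ is the beamwidth; $f_{R_k}$ is its PDF. Other constants: transmit power $P_{\mathrm t}>0$, main-lobe gain $G_{\mathrm c}>0$, noise power $N_0>0$, path-loss exponent $\alpha>0$, absorption coefficient $\kappa_f>0$, UAV density $\lambda_u>0$, UAV activation probability $p_{\mathrm a}\in[0,1]$ (probability that a UAV senses at least one vehicle during its full scan). The SINR of the $k$th nearest vehicle is $$\mathrm{SINR}_k=\frac{P_{\mathrm t}G_{\mathrm c}h_{\mathrm o}\,d(R_k)^{-\alpha}e^{-\kappa_f d(R_k)}}{I_k+N_0},$$ where $h_{\mathrm o}$ is exponential with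 mean 1 and independent of $R_k$ and $I_k$. Given $R_k=r$ and the vehicle location $\mathbf x_k$, $$I_k=\sum_{\mathbf y\in\Phi_u^{\mathrm a}\setminus b_2(\mathbf x_k,r)}P_{\mathrm t}G_{\mathbf y}h_{\mathbf y}\,d(\|\mathbf y-\mathbf x_k\|)^{-\alpha}e^{-\kappa_f d(\|\mathbf y-\mathbf x_k\|)}\,\mathbb 1_{\mathbf y}(\mathrm{LoS}),$$ where $\Phi_u^{\mathrm a}$ is a homogeneous PPP on $\mathbb R^2$ of intensity $\lambda_u p_{\mathrm a}$ independent of $R_k,\mathbf x_k$, $b_2(\mathbf x_k,r)$ is the disk of radius $r$ centred at $\mathbf x_k$, $h_{\mathbf y}$ are i.i.d. exponential with mean 1, $\mathbb 1_{\mathbf y}(\mathrm{LoS})$ are independent Bernoulli with parameter $p_{\mathsf L}(\|\mathbf y-\mathbf x_k\|,H)$, and $G_{\mathbf y}$ are i.i.d., equal to $G_{\mathrm c}$ with probability $\gamma/(2\pi)$ (beam of $\mathbf y$ aligned with the vehicle) and $0$ otherwise; all independent. For $R_k=r$, $\mathcal L_{I_k}(s)=\mathbb E[e^{-sI_k}\mid R_k=r]$. *)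

(* Defs.v *)
From HB Require Import structures.
From mathcomp Require Import all_boot all_order all_algebra.
From mathcomp Require Import all_classical all_reals all_analysis.
From mathcomp Require Import measurable_realfun.

Set Implicit Arguments.
Unset Strict Implicit.
Unset Printing Implicit Defensive.

Import Order.TTheory GRing.Theory Num.Theory.
Import numFieldNormedType.Exports.

Local Open Scope classical_set_scope.
Local Open Scope card_scope.
Local Open Scope ring_scope.

Section probability_notions.
Context {R : realType} {dT : measure_display} {T : measurableType dT}.
Variable P : probability T R.

Definition sigma_rv {dE : measure_display} {E : measurableType dE}
    (X : T -> E) : set (set T) :=
  preimage_set_system setT X measurable.

(* Finite subfamilies of distinct indices are injections from 'I_n. *)
Definition mutually_independent {J : Type} (G : J -> set (set T)) : Prop :=
  forall (n : nat) (j : 'I_n -> J) (A : 'I_n -> set T),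
    injective j -> (forall i, G (j i) (A i)) ->
    P (\bigcap_i A i) = (\prod_(i < n) P (A i))%E.

Definition independent2 (G1 G2 : set (set T)) : Prop :=
  forall A B, G1 A -> G2 B -> P (A `&` B) = (P A * P B)%E.

(* Given the sigma-algebra G, the marks D j are independent Bernoulli variables
   with G-measurable success probabilities p j. *)
Definition cond_independent_bernoulli {J : Type} (G : set (set T))
    (D : J -> T -> bool) (p : J -> T -> R) : Prop :=
  (forall j, measurable_fun setT (D j)) /\
  forall (n : nat) (j : 'I_n -> J) (A : set T),
    injective j -> G A ->
    P (A `&` \bigcap_i [set w | D (j i) w]) =
    (\int[P]_(w in A) (\prod_(i < n) p (j i) w)%:E)%E.

Definition exponential_mean1 (h : T -> R) : Prop :=
  measurable_fun setT h /\
  forall B, measurable B -> P (h @^-1` B) = exponential_prob 1 B.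

Definition is_pdf (X : T -> R) (f : R -> R) : Prop :=
  [/\ measurable_fun setT f, (forall x, 0 <= f x) &
      forall B, measurable B ->
        P (X @^-1` B) = (\int[lebesgue_measure]_(x in B) (f x)%:E)%E].

(* K is a regular conditional distribution of Y given X: K r is the law of Y
   given X = r.  It is determined up to a null set of values r for the law of
   X, and, unlike a choice of a version of E[g(Y) | X = r] for each g
   separately, it allows g to depend on r. *)
Definition is_conditional_law (X : T -> R) (Y : T -> \bar R)
    (K : R.-pker R ~> \bar R) : Prop :=
  forall A B, measurable A -> measurable B ->
    P (X @^-1` A `&` Y @^-1` B) = (\int[P]_(w in X @^-1` A) K (X w) B)%E.

End probability_notions.

(* E[exp(- s Y) | X = r] for K the conditional law of Y given X. *)
Definition cond_laplace {R : realType}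
    (K : R.-pker R ~> \bar R) (r s : R) : R :=
  fine (\int[K r]_y expeR (- (s%:E * y)))%E.

(* A point process is given by a measurable enumeration X of its points;
   X i w = None means that there is no i-th point (an enumeration by nat of
   exactly all points need not exist, e.g. for intensity 0). *)
Section point_processes.
Context {R : realType} {dT : measure_display} {T : measurableType dT}.
Context {dE : measure_display} {E : measurableType dE}.
Variable P : probability T R.

Definition in_region (X : nat -> T -> option E) (i : nat) (B : set E) : set T :=
  X i @^-1` (Some @` B).

Definition sigma_points (X : nat -> T -> option E) : set (set T) :=
  <<s [set A | exists i, exists2 B, measurable B & A = in_region X i B] >>.

Definition count_event (X : nat -> T -> option E) (B : set E) (n : nat) : set T :=
  [set w | [set i | in_region X i B w] #= `I_n].

(* Unlike the library's poisson_pmf, this is the Dirac mass at 0 when m = 0. *)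
Definition poisson_mass (m : R) (n : nat) : R := m ^+ n / n`!%:R * expR (- m).

Record homogeneous_ppp (mu : set E -> \bar R) (lam : R)
    (X : nat -> T -> option E) : Prop := {
  ppp_measurable : forall i B, measurable B -> measurable (in_region X i B) ;
  ppp_counts : forall (n : nat) (B : 'I_n -> set E) (c : 'I_n -> nat),
    (forall i, measurable (B i)) -> (forall i, mu (B i) < +oo)%E ->
    trivIset setT B ->
    P (\bigcap_i count_event X (B i) (c i)) =
    (\prod_(i < n) poisson_mass (lam * fine (mu (B i))) (c i))%:E }.

End point_processes.

Record system_params (R : realType) := SystemParams {
  road_density : R ;
  vehicle_density : R ;
  altitude : R ;
  los_a : R ;
  los_b : R ;
  beamwidth : R ;
  tx_power : R ;
  main_gain : R ;
  noise : R ;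
  path_loss : R ;
  absorption : R ;
  uav_density : R ;
  activation_prob : R ;
  road_density_gt0 : 0 < road_density ;
  vehicle_density_gt0 : 0 < vehicle_density ;
  altitude_gt0 : 0 < altitude ;
  los_a_gt0 : 0 < los_a ;
  los_b_gt0 : 0 < los_b ;
  beamwidth_gt0 : 0 < beamwidth ;
  beamwidth_ltpi : beamwidth < pi ;
  tx_power_gt0 : 0 < tx_power ;
  main_gain_gt0 : 0 < main_gain ;
  noise_gt0 : 0 < noise ;
  path_loss_gt0 : 0 < path_loss ;
  absorption_gt0 : 0 < absorption ;
  uav_density_gt0 : 0 < uav_density ;
  activation_prob_ge0 : 0 <= activation_prob ;
  activation_prob_le1 : activation_prob <= 1 }.

Section geometry.
Context {R : realType}.
Variable q : system_params R.

(* The library norm on R * R is the sup norm. *)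
Definition norm2 (x : R * R) : R := Num.sqrt (x.1 ^+ 2 + x.2 ^+ 2).

(* r = 0 is separate because altitude / 0 is 0 in the library. *)
Definition elevation (r : R) : R :=
  if r == 0 then pi / 2 else atan (altitude q / r).

Definition los_prob (r : R) : R :=
  (1 + los_a q * expR (- los_b q * (180 / pi * elevation r - los_a q)))^-1.

Definition link_dist (r : R) : R := Num.sqrt (r ^+ 2 + altitude q ^+ 2).

Definition path_gain (r : R) : R :=
  link_dist r `^ (- path_loss q) * expR (- absorption q * link_dist r).

(* x has a polar angle theta with |theta| <= beamwidth / 2. *)
Definition in_sector (x : R * R) : Prop :=
  exists theta : R, [/\ `|theta| <= beamwidth q / 2,
    x.1 = norm2 x * cos theta & x.2 = norm2 x * sin theta].

End geometry.

(* The Boolean is the orientation of a road: false for the horizontal lines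
   y = rho_i, true for the vertical lines x = rho'_i.  traffic b i enumerates
   the positions, along the i-th road of orientation b, of its vehicles. *)
Record vehicle_network (R : realType) (dT : measure_display)
    (T : measurableType dT) := VehicleNetwork {
  road : bool -> nat -> T -> option R ;
  traffic : bool -> nat -> nat -> T -> option R ;
  detectable : bool * nat * nat -> T -> bool }.

Inductive traffic_source := RoadOffsets of bool | RoadTraffic of bool & nat.

Section vehicles.
Context {R : realType} {dT : measure_display} {T : measurableType dT}.
Variables (q : system_params R) (P : probability T R).
Variable V : vehicle_network R T.

Definition vehicle_location (n : bool * nat * nat) (w : T) : option (R * R) :=
  let: (b, i, j) := n in
  if road V b i w is Some rho then
    if traffic V b i j w is Some t then Some (if b then (rho, t) else (t, rho))
    else None
  else None.

Definition sigma_traffic (s : traffic_source) : set (set T) :=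
  match s with
  | RoadOffsets b => sigma_points (road V b)
  | RoadTraffic b i => sigma_points (traffic V b i)
  end.

Record manhattan_cox_network : Prop := {
  roads_ppp : forall b,
    homogeneous_ppp P lebesgue_measure (road_density q) (road V b) ;
  traffic_ppp : forall b i,
    homogeneous_ppp P lebesgue_measure (vehicle_density q) (traffic V b i) ;
  traffic_independent : mutually_independent P sigma_traffic ;
  detectable_marks : cond_independent_bernoulli P
    <<s \bigcup_s sigma_traffic s >> (detectable V)
    (fun n w => oapp (fun x => los_prob q (norm2 x)) 0 (vehicle_location n w)) }.

Definition sensed (w : T) (n : bool * nat * nat) (x : R * R) : Prop :=
  [/\ vehicle_location n w = Some x, detectable V n w & in_sector q x].

(* Exactly k - 1 sensed vehicles are strictly closer than vehicle n, located at
   x, and exactly k are at least as close (vehicle n included). *)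
Definition is_kth_nearest (k : nat) (w : T) (n : bool * nat * nat) (x : R * R)
    : Prop :=
  [/\ sensed w n x,
      [set m | exists2 y, sensed w m y & norm2 y < norm2 x] #= `I_k.-1 &
      [set m | exists2 y, sensed w m y & norm2 y <= norm2 x] #= `I_k].

(* There is at most one k-th nearest vehicle; the default value is used when
   there is none, which happens with probability 0. *)
Definition kth_location (k : nat) (w : T) : R * R :=
  xget (0, 0) [set x | exists n, is_kth_nearest k w n x].

Definition kth_distance (k : nat) (w : T) : R := norm2 (kth_location k w).

End vehicles.

Record uav_network (R : realType) (dT : measure_display)
    (T : measurableType dT) := UavNetwork {
  uav_location : nat -> T -> option (R * R) ;
  uav_fading : nat -> T -> R ;
  uav_gain : nat -> T -> R ;
  uav_los : nat -> T -> bool }.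

Inductive uav_source :=
  TargetVehicle | UavLocations | UavFading of nat | UavGain of nat.

Section uavs.
Context {R : realType} {dT : measure_display} {T : measurableType dT}.
Variables (q : system_params R) (P : probability T R).
Variables (xk : T -> R * R) (U : uav_network R T).

Definition sigma_uav (s : uav_source) : set (set T) :=
  match s with
  | TargetVehicle => sigma_rv xk
  | UavLocations => sigma_points (uav_location U)
  | UavFading i => sigma_rv (uav_fading U i)
  | UavGain i => sigma_rv (uav_gain U i)
  end.

(* The active UAVs and their marks, as seen from the vehicle located at xk. *)
Record active_uav_network : Prop := {
  uav_ppp : homogeneous_ppp P (lebesgue_measure \x lebesgue_measure)%E
    (uav_density q * activation_prob q) (uav_location U) ;
  uav_fading_law : forall i, exponential_mean1 P (uav_fading U i) ;
  uav_gain_measurable : forall i, measurable_fun setT (uav_gain U i) ;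
  uav_gain_main : forall i, P (uav_gain U i @^-1` [set main_gain q]) =
    (beamwidth q / (2 * pi))%:E ;
  uav_gain_zero : forall i, P (uav_gain U i @^-1` [set 0]) =
    (1 - beamwidth q / (2 * pi))%:E ;
  uav_independent : mutually_independent P sigma_uav ;
  uav_los_marks : cond_independent_bernoulli P
    <<s \bigcup_s sigma_uav s >> (uav_los U)
    (fun i w =>
       oapp (fun y => los_prob q (norm2 (y - xk w))) 0 (uav_location U i w)) }.

(* Sum over the UAVs outside the closed disk of centre xk and radius rk. *)
Definition interference (rk : T -> R) (w : T) : \bar R :=
  (\esum_(i in [set: nat])
    oapp (fun y : R * R =>
      if (rk w < norm2 (y - xk w))%R then
        (tx_power q * uav_gain U i w * uav_fading U i w *
         path_gain q (norm2 (y - xk w)) * (uav_los U i w)%:R)%:E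
      else 0) 0 (uav_location U i w))%E.

End uavs.

Section coverage.
Context {R : realType} {dT : measure_display} {T : measurableType dT}.
Variables (q : system_params R) (P : probability T R).
Variables (V : vehicle_network R T) (U : uav_network R T).
Variables (ho : T -> R) (k : nat).

Definition kth_interference : T -> \bar R :=
  interference q (kth_location q V k) U (kth_distance q V k).

(* In the extended reals, the quotient is 0 when the interference is +oo. *)
Definition sinr (w : T) : \bar R :=
  ((tx_power q * main_gain q * ho w * path_gain q (kth_distance q V k w))%:E
   / (kth_interference w + (noise q)%:E))%E.

Definition coverage_prob (rs tau : R) : R :=
  fine (P [set w | (tau%:E < sinr w)%E /\ kth_distance q V k w <= rs])
  / fine (P [set w | kth_distance q V k w <= rs]).

End coverage.

(* Main.v *)
Require Import Defs.
From HB Require Import structures.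
From mathcomp Require Import all_boot all_order all_algebra.
From mathcomp Require Import finmap.
From mathcomp Require Import all_classical all_reals all_analysis.
From mathcomp Require Import measurable_realfun ring lra.
Import Order.TTheory GRing.Theory Num.Theory.
Import numFieldNormedType.Exports.
Local Open Scope classical_set_scope.
Local Open Scope ring_scope.

(** Up to the measurability of the k-th nearest location and of the
    interference, the formula is the exponential tail averaged over the law of
    [(R_k, I_k)].  The event [SINR_k > tau] is [s(R_k) * (I_k + N_0) < h_o] with
    [s(r) = tau * d(r)^alpha * exp(kappa_f * d(r)) / (P_t * G_c)]; since [h_o] is
    exponential and independent of [(R_k, I_k)], its conditional probability is
    [exp (- s(R_k) * N_0) * exp (- s(R_k) * I_k)].  Integrating [I_k] against its
    conditional law given [R_k = r] turns the second factor into the Laplace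
    transform at [s(r)], and the density of [R_k] gives the integral over [r]. *)

(** * Integration against a mixture of measures *)

Section mixtures.
Local Open Scope ereal_scope.
Import HBNNSimple.

(** The hypothesis on sets extends by linearity to simple functions, then by monotone convergence
    along [nnsfun_approx] to every nonnegative measurable [g]. Taking [kappa] as a bare family of
    measures lets pushforwards and scaled Dirac masses be used directly. *)
Lemma integral_mixture (d d' : measure_display) (X : measurableType d)
    (Z : measurableType d') (R : realType) (mu : {measure set X -> \bar R})
    (nu : {measure set Z -> \bar R}) (kappa : X -> {measure set Z -> \bar R})
    (g : Z -> \bar R) :
  (forall U, measurable U -> measurable_fun setT (kappa ^~ U)) ->
  (forall U, measurable U -> nu U = \int[mu]_x kappa x U) ->
  (forall z, 0 <= g z) -> measurable_fun setT g ->
  \int[nu]_z g z = \int[mu]_x \int[kappa x]_z g z.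
Proof.
move=> mkappa nuE g0 mg.
have nnsfunE (h : {nnsfun Z >-> R}) :
    \int[nu]_z (h z)%:E = \int[mu]_x \int[kappa x]_z (h z)%:E.
  rewrite integralT_nnsfun sintegralE.
  under [RHS]eq_integral do rewrite integralT_nnsfun sintegralE.
  have mh r : measurable_fun setT (fun x => r%:E * kappa x (h @^-1` [set r])).
    exact: measurable_funeM (mkappa _ _).
  rewrite ge0_integral_fsum//; last first.
    move=> r x _.
    exact: (mulemu_ge0 (fun r => h @^-1` [set r]) (@preimage_nnfun0 _ _ h r)).
  apply: eq_fsbigr => r _; rewrite nuE//.
  (* The factor [r] leaves the integral when it is nonnegative; a negative [r] is not a value of
     [h], so its preimage is empty and both terms vanish. *)
  have [r0|r0] := leP 0%R r; first by rewrite ge0_integralZl//; exact: mkappa.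
  rewrite !integral0_eq ?mule0// => x _; rewrite preimage_nnfun0// measure0//.
  by rewrite mule0.
pose g_ := nnsfun_approx measurableT mg.
have limE (m : {measure set Z -> \bar R}) :
    \int[m]_z g z = limn (fun n => \int[m]_z (g_ n z)%:E).
  rewrite -monotone_convergence//; last 3 first.
  - by move=> n; exact/measurable_EFinP.
  - by move=> n z _; rewrite lee_fin.
  - by move=> z _ a b ab; rewrite lee_fin; exact/lefP/nd_nnsfun_approx.
  by apply: eq_integral => z _; apply/esym/cvg_lim => //; exact: cvg_nnsfun_approx.
rewrite limE; under eq_fun do rewrite nnsfunE.
rewrite -monotone_convergence//; last 3 first.
- move=> n; apply: measurable_fun_integral_kernel => //.
    by move=> z; rewrite lee_fin.
  exact/measurable_EFinP.
- by move=> n x _; apply: integral_ge0 => z _; rewrite lee_fin.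
- move=> x _ a b ab; apply: ge0_le_integral => //.
  + by move=> z _; rewrite lee_fin.
  + exact/measurable_EFinP.
  + exact/measurable_EFinP.
  + by move=> z _; rewrite lee_fin; exact/lefP/nd_nnsfun_approx.
by apply: eq_integral => x _; rewrite -limE.
Qed.

End mixtures.

(** * Regular conditional laws and the joint law they determine *)

Section conditional_laws.
Local Open Scope ereal_scope.
Context (R : realType) (dT : measure_display) (T : measurableType dT).
Context (P : probability T R).
Context (d1 d2 : measure_display).
Context (E1 : measurableType d1) (E2 : measurableType d2).
Context (X : T -> E1) (Y : T -> E2) (K : R.-pker E1 ~> E2).
Hypothesis mX : measurable_fun setT X.
Hypothesis mY : measurable_fun setT Y.
Hypothesis K_law : forall A B, measurable A -> measurable B ->
  P (X @^-1` A `&` Y @^-1` B) = \int[P]_(w in X @^-1` A) K (X w) B.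

Lemma measurable_kernel_xsection (U : set (E1 * E2)) : measurable U ->
  measurable_fun setT (fun w => K (X w) (xsection U (X w))).
Proof.
move=> mU; apply: (measurableT_comp (f := fun x => K x (xsection U x))) => //.
by apply: measurable_fun_xsection_finite_kernel; rewrite inE.
Qed.

(** [K_law] is the case of rectangles. These form a pi-system generating the product sigma-algebra,
    and the sets satisfying the identity are stable under complement and countable disjoint
    union. *)
Lemma conditional_law_joint (U : set (E1 * E2)) : measurable U ->
  P [set w | U (X w, Y w)] = \int[P]_w K (X w) (xsection U (X w)).
Proof.
have mXY : measurable_fun setT (fun w => (X w, Y w)).
  exact: measurable_fun_pair.
have mpre V : measurable V -> measurable [set w | V (X w, Y w)].
  by move=> mV; rewrite -[X in measurable X]setTI; exact: mXY.
pose G := [set A `*` B | A in @measurable _ E1 & B in @measurable _ E2].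
have GE : @measurable _ (E1 * E2)%type = <<s G >>.
  exact: measurable_prod_measurableType.
rewrite {1}GE; move: U; apply: (@dynkin_induction _ _ G) => //.
- move=> _ _ [A1 mA1 [B1 mB1 <-]] [A2 mA2 [B2 mB2 <-]].
  rewrite -setXI; exists (A1 `&` A2); first exact: measurableI.
  by exists (B1 `&` B2) => //; exact: measurableI.
- rewrite /= (eq_integral (cst 1)) => [|w _].
    by rewrite integral_cst// mul1e.
  rewrite (_ : xsection _ _ = setT) ?prob_kernel//.
  by apply/seteqP; split=> // y _; rewrite /xsection/= inE.
- move=> _ [A mA [B mB <-]].
  rewrite (_ : [set w | _] = X @^-1` A `&` Y @^-1` B)//.
  rewrite K_law// integral_mkcond; apply: eq_integral => w _.
  rewrite patchE; case: ifPn => [|]; rewrite ?notin_setE ?in_setE => XA.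
    by rewrite in_xsectionX ?inE.
  by rewrite notin_xsectionX ?measure0 // notin_setE.
- move=> S mS PS.
  rewrite (_ : [set w | _] = ~` [set w | S (X w, Y w)])//.
  rewrite probability_setC ?PS; last exact: mpre.
  (* Each [K (X w)] has total mass 1, so the integrals for [S] and its complement add up to 1. The
     first one is a probability, hence finite, and can be subtracted. *)
  have sum1 : \int[P]_w K (X w) (xsection S (X w)) +
              \int[P]_w K (X w) (xsection (~` S) (X w)) = 1.
    rewrite -ge0_integralD//; last 2 first.
    - exact: measurable_kernel_xsection.
    - by apply: measurable_kernel_xsection; exact: measurableC.
    rewrite (eq_integral (cst 1)) => [|w _].
      by rewrite integral_cst// mul1e -(probability_setT P).
    have -> : xsection (~` S) (X w) = ~` xsection S (X w).
      by apply/seteqP; split=> y; rewrite /xsection/= !inE.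
    rewrite /= -measureU//; [|exact: measurable_xsection| |].
    + by rewrite setUv; exact: prob_kernel.
    + by apply: measurableC; exact: measurable_xsection.
    + by rewrite setICr.
  rewrite -sum1 addeAC subee ?add0e// -PS.
  by apply: fin_num_measure; exact: mpre.
- move=> F mF tF PF.
  rewrite (_ : [set w | _] = \bigcup_n [set w | F n (X w, Y w)]); last first.
    by apply/seteqP; split=> w [n _ Fn]; exists n.
  transitivity (\sum_(n <oo) P [set w | F n (X w, Y w)]).
    apply/esym/cvg_lim => //; apply: measure_sigma_additive.
      by move=> n; exact: mpre.
    by move=> i j _ _ [w [/= Fi Fj]]; apply: tF => //; exists (X w, Y w).
  under eq_eseriesr do rewrite PF.
  rewrite -integral_nneseries//; last first.
    by move=> n; exact: measurable_kernel_xsection.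
  apply: eq_integral => w _; rewrite xsection_bigcup.
  apply/cvg_lim => //; apply: measure_sigma_additive.
    by move=> n; exact: measurable_xsection.
  exact: trivIset_xsection.
Qed.
End conditional_laws.

(** * The tail of the exponential law *)

Lemma exponential_prob_itvoy (R : realType) (rate x : R) :
  0 < rate -> 0 <= x ->
  exponential_prob rate `]x, +oo[ = (expR (- rate * x))%:E.
Proof.
move=> rate0 x0; rewrite /exponential_prob integral_itv_obnd_cbnd; last first.
  by apply/measurable_funTS/measurable_EFinP; exact: measurable_exponential_pdf.
have cexp : continuous (fun z : R^o => expR (- rate * z)).
  move=> z; apply: continuous_comp; last exact: continuous_expR.
  exact: mulrl_continuous.
(* The antiderivative [- expR (- rate * x)] tends to 0 at infinity; [0 <= x] keeps the interval
   where the density has its exponential form. *)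
rewrite (@ge0_continuous_FTC2y _ _ (fun x => - (expR (- rate * x))) _ 0)//.
- by rewrite EFinN oppeK add0e.
- by move=> z _; apply: exponential_pdf_ge0; exact: ltW.
- apply: continuous_subspaceW (@within_continuous_exponential_pdf R rate).
  by move=> z /=; rewrite !in_itv/= !andbT; exact: le_trans.
- rewrite -oppr0; apply: cvgN; under eq_fun do rewrite mulNr.
  apply: (@cvg_comp _ _ _ ( *%R rate) (fun z => expR (- z)) _ (pinfty_nbhs R)).
    exact: gt0_cvgMry.
  exact: cvgr_expR.
- by apply: cvgN; apply/cvg_at_right_filter; exact: cexp.
- move=> z; rewrite in_itv/= andbT => xz.
  by apply: derive1_exponential_pdf; rewrite in_itv/= andbT (le_lt_trans x0).
Qed.

(** The value [y = +oo] is included because the interference may be infinite: the event is then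
    empty and [expeR] vanishes at [-oo]. *)
Lemma exponential_prob1_gt (R : realType) (y : \bar R) : (0 <= y)%E ->
  exponential_prob 1 [set h | (y < h%:E)%E] = expeR (- y)%E.
Proof.
case: y => [x|_|//]; last first.
  rewrite (_ : [set h | _] = set0); last by rewrite -subset0 => h.
  by rewrite /exponential_prob integral_set0.
rewrite lee_fin => x0; rewrite (_ : [set h | _] = `]x, +oo[%classic).
  by rewrite exponential_prob_itvoy//= mulN1r.
by apply/seteqP; split=> h /=; rewrite in_itv/= andbT lte_fin.
Qed.

(** * Integrals of functions of several random variables *)

Section joint_integrals.
Local Open Scope ereal_scope.
Context (R : realType) (dT : measure_display) (T : measurableType dT).
Context (P : probability T R).
Context (d1 d2 : measure_display).
Context (E1 : measurableType d1) (E2 : measurableType d2).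

(** The law of [(X, Y)] is the mixture, over [w] distributed as [P], of the images of [K (X w)]
    under the map sending [y] to [(X w, y)]; [integral_mixture] then applies. *)
Lemma conditional_law_integral (X : T -> E1) (Y : T -> E2)
    (K : R.-pker E1 ~> E2) (g : E1 * E2 -> \bar R) :
  measurable_fun setT X -> measurable_fun setT Y ->
  (forall A B, measurable A -> measurable B ->
    P (X @^-1` A `&` Y @^-1` B) = \int[P]_(w in X @^-1` A) K (X w) B) ->
  (forall z, 0 <= g z) -> measurable_fun setT g ->
  \int[P]_w g (X w, Y w) = \int[P]_w \int[K (X w)]_y g (X w, y).
Proof.
move=> mX mY K_law g0 mg.
have mXY : measurable_fun setT (fun w => (X w, Y w)).
  exact: measurable_fun_pair.
have mpair w := pair1_measurable (X w) : measurable_fun setT (pair (X w) : E2 -> _).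
pose kappa w : {measure set (E1 * E2) -> \bar R} :=
  pushforward (K (X w)) (pair (X w)).
pose nu : {measure set (E1 * E2) -> \bar R} := pushforward P (fun w => (X w, Y w)).
have kappaE w U : kappa mpair w U = K (X w) (xsection U (X w)).
  by rewrite /kappa /pushforward xsectionE.
transitivity (\int[nu mXY]_z g z); first by rewrite ge0_integral_pushforward.
rewrite (@integral_mixture _ _ _ _ _ P (nu mXY) (kappa mpair))//.
- by apply: eq_integral => w _; rewrite ge0_integral_pushforward.
- move=> U mU; under eq_fun do rewrite kappaE.
  exact: measurable_kernel_xsection.
- move=> U mU; under eq_integral do rewrite kappaE.
  exact: conditional_law_joint.
Qed.

(* By independence, [mu] is a conditional law of [h] given [X]. *)
Lemma independent_joint_law (X : T -> E1) (h : T -> E2) (mu : probability E2 R)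
    (U : set (E1 * E2)) :
  measurable_fun setT X -> measurable_fun setT h ->
  (forall B, measurable B -> P (h @^-1` B) = mu B) ->
  independent2 P (sigma_rv h) (sigma_rv X) -> measurable U ->
  P [set w | U (X w, h w)] = \int[P]_w mu (xsection U (X w)).
Proof.
move=> mX mh h_law hX mU.
pose K := kprobability (@measurable_cst _ _ E1 _ setT (mu : pprobability E2 R)).
rewrite (@conditional_law_joint _ _ _ _ _ _ _ _ X h K)// => A B mA mB.
rewrite (eq_integral (cst (mu B)))// integral_cst; last first.
  by rewrite -[X in measurable X]setTI; exact: mX.
rewrite -h_law// setIC; apply: hX; first by exists B; rewrite // setTI.
by exists A; rewrite // setTI.
Qed.

End joint_integrals.

Lemma pdf_integral (R : realType) (dT : measure_display) (T : measurableType dT)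
    (P : probability T R) (X : T -> R) (f : R -> R) (g : R -> \bar R) :
  measurable_fun setT X -> is_pdf P X f ->
  (forall x, 0 <= g x)%E -> measurable_fun setT g ->
  (\int[P]_w g (X w) = \int[lebesgue_measure]_x (g x * (f x)%:E))%E.
Proof.
move=> mX [mf f0 fE] g0 mg.
pose nu : {measure set R -> \bar R} := pushforward P X.
(* The law of [X] is the mixture of the Dirac masses at [x] with weights [f x]. *)
pose kappa (x : R) : {measure set R -> \bar R} := mscale (NngNum (f0 x)) \d_x.
have kappaE x U : kappa x U = ((f x * \1_U x)%R)%:E.
  by rewrite /kappa/= /mscale/= diracE EFinM indicE.
transitivity (\int[nu mX]_x g x)%E; first by rewrite ge0_integral_pushforward.
rewrite (@integral_mixture _ _ _ _ _ lebesgue_measure (nu mX) kappa)//.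
- apply: eq_integral => x _; rewrite ge0_integral_mscale//= integral_dirac//.
  by rewrite diracT mul1e muleC.
- move=> U mU; under eq_fun do rewrite kappaE.
  by apply/measurable_EFinP/measurable_funM => //; exact: measurable_indic.
- move=> U mU; under eq_integral do rewrite kappaE.
  transitivity (P (X @^-1` U)) => //; rewrite fE// [LHS]integral_mkcond.
  by congr (integral _ _ _); rewrite epatch_indic.
Qed.

(** [expeR] is strictly increasing onto the nonnegative extended reals, so the preimage of an upper
    ray is everything or an upper ray. *)
Lemma measurable_expeR (R : realType) : measurable_fun setT (@expeR R).
Proof.
apply: (measurability _ (ErealGenOInfty.measurableE R)) => _ [_ [r ->] <-].
rewrite setTI; have [r0|r0] := leP 0 r; last first.
  rewrite (_ : _ @^-1` _ = setT)//; apply/seteqP; split=> // x _ /=.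
  by rewrite in_itv/= andbT (lt_le_trans _ (expeR_ge0 x)).
have [y yr] := @expeR_total R r%:E r0.
rewrite (_ : _ @^-1` _ = `]y, +oo[%classic); first exact: emeasurable_itv.
by apply/seteqP; split=> x /=; rewrite !in_itv/= !andbT -yr lte_expeR.
Qed.

(* No finiteness hypothesis: an infinite product has [fine] equal to [0]. *)
Lemma fineMr (R : realDomainType) (x : \bar R) (b : R) :
  fine (x * b%:E) = fine x * b.
Proof.
case: x => [r| |] //=; rewrite mul0r; have [b0|b0|->] := ltgtP b 0.
- by rewrite lt0_mulye ?lte_fin.
- by rewrite gt0_mulye ?lte_fin.
- by rewrite mule0.
- by rewrite lt0_mulNye ?lte_fin.
- by rewrite gt0_mulNye ?lte_fin.
- by rewrite mule0.
Qed.

(** * Probability that an exponential variable exceeds a random threshold *)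

Section coverage_formula.
Context (R : realType) (dT : measure_display) (T : measurableType dT).
Context (P : probability T R) (h X : T -> R) (Y : T -> \bar R) (f s : R -> R).
Context (K : R.-pker R ~> \bar R) (N : R) (D : set R).
Hypothesis mX : measurable_fun setT X.
Hypothesis mY : measurable_fun setT Y.
Hypothesis ms : measurable_fun setT s.
Hypothesis mD : measurable D.
Hypothesis N0 : 0 <= N.
Hypothesis s0 : forall r, 0 <= s r.
Hypothesis Y0 : forall w, (0 <= Y w)%E.
Hypothesis h_exp : exponential_mean1 P h.
Hypothesis h_indep : independent2 P (sigma_rv h) (sigma_rv (fun w => (X w, Y w))).
Hypothesis f_pdf : is_pdf P X f.
Hypothesis K_law : is_conditional_law P X Y K.

Let threshold (z : R * \bar R) : \bar R := ((s z.1)%:E * (z.2 + N%:E))%E.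

Let measurable_threshold : measurable_fun setT threshold.
Proof.
apply: emeasurable_funM.
  by apply/measurable_EFinP; exact: measurableT_comp.
exact: emeasurable_funD.
Qed.

(** At [(X, Y)], this is the conditional probability given [(X, Y)] that [h] exceeds the threshold
    and [X] lies in [D]. *)
Let g (z : R * \bar R) : \bar R := (expeR (- threshold z) * (\1_D z.1)%:E)%E.

Let measurable_g : measurable_fun setT g.
Proof.
apply: emeasurable_funM.
  apply: (measurableT_comp (@measurable_expeR R)).
  exact: measurableT_comp.
by apply/measurable_EFinP; apply: measurableT_comp => //; exact: measurable_indic.
Qed.

Let g_ge0 z : (0 <= g z)%E.
Proof. by rewrite mule_ge0 ?expeR_ge0// lee_fin. Qed.

(** The pair is grouped first so that the section of [U] at [(X w, Y w)] is a set of values of [h]: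
    an upper ray, or empty when [X w] is outside [D]. *)
Let U := [set u : (R * \bar R) * R | (threshold u.1 < u.2%:E)%E /\ D u.1.1].

Let measurable_U : measurable U.
Proof.
have -> : U = [set u | (threshold u.1 < u.2%:E)%E] `&`
              (fun u : (R * \bar R) * R => u.1.1) @^-1` D by [].
apply: measurableI.
  rewrite -[X in measurable X]setTI.
  apply: measurable_lte => //; first exact: measurableT_comp.
  exact/measurable_EFinP.
rewrite -[X in measurable X]setTI.
by apply: (measurableT_comp (f := fst)).
Qed.

Lemma exponential_exceeds_probability :
  P [set w | ((s (X w))%:E * (Y w + N%:E) < (h w)%:E)%E /\ D (X w)] =
  (\int[lebesgue_measure]_(r in D)
    ((expR (- (s r * N)))%:E * (\int[K r]_y expeR (- ((s r)%:E * y)))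
     * (f r)%:E))%E.
Proof.
have [mh h_law] := h_exp.
have mXY : measurable_fun setT (fun w => (X w, Y w)).
  exact: measurable_fun_pair.
pose Q : probability _ R := exponential_prob 1.
transitivity (\int[P]_w Q ltr01 (xsection U (X w, Y w)))%E.
  exact: (@independent_joint_law _ _ _ _ _ _ _ (measurableTypeR R)
    (fun w => (X w, Y w))).
transitivity (\int[P]_w g (X w, Y w))%E.
  apply: eq_integral => w _.
  rewrite /g indicE; have [XD|XD] := boolP (X w \in D).
    rewrite mule1 -exponential_prob1_gt; last first.
      by rewrite mule_ge0 ?adde_ge0 ?lee_fin//=.
    congr (exponential_prob 1 _); apply/seteqP; split=> r; rewrite /xsection/= inE.
      by case.
    by split=> //; rewrite -in_setE.
  rewrite mule0 (_ : xsection _ _ = set0) ?measure0//.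
  rewrite -subset0 => r; rewrite /xsection/= inE => -[_ /=].
  by move: XD; rewrite notin_setE.
rewrite (@conditional_law_integral _ _ _ _ _ _ _ _ X Y K g)//.
rewrite (@pdf_integral _ _ _ P X f (fun r => \int[K r]_y g (r, y))%E)//; last 2 first.
- by move=> r; exact: integral_ge0.
- exact: (measurable_fun_integral_finite_kernel g K).
rewrite [RHS]integral_mkcond; apply: eq_integral => r _; rewrite patchE.
case: ifPn => [rD|rD].
  congr (_ * _)%E; rewrite -ge0_integralZl//.
  - apply: eq_integral => y _.
    (* Since [s r] and [N] are finite, the exponent splits for every extended real [y], even
       negative or infinite. *)
    rewrite /g indicE rD mule1 /threshold/= muleDr ?fin_num_adde_defl//.
    by rewrite fin_num_oppeD// expeRD muleC.
  - apply: (measurableT_comp (@measurable_expeR R)).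
    apply: measurableT_comp => //.
    exact: measurable_funeM.
  - by move=> y _; exact: expeR_ge0.
rewrite integral0_eq ?mul0e// => y _.
by rewrite /g indicE (negbTE rD) mule0.
Qed.

(** [cond_laplace] takes [fine], which would replace an infinite value by 0. The extended integrand
    [Phi] has a probability as its integral over [D], so it is finite almost everywhere there, and
    [fine] changes it only on a null set. *)
Lemma exponential_exceeds_Rintegral :
  fine (P [set w | ((s (X w))%:E * (Y w + N%:E) < (h w)%:E)%E /\ D (X w)]) =
  \int[lebesgue_measure]_(r in D)
    (expR (- (s r * N)) * cond_laplace K r (s r) * f r).
Proof.
pose Phi r : \bar R := ((expR (- (s r * N)))%:E *
  (\int[K r]_y expeR (- ((s r)%:E * y))) * (f r)%:E)%E.
have [mf f0 _] := f_pdf.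
have Phi0 r : (0 <= Phi r)%E.
  by rewrite !mule_ge0 ?lee_fin ?expR_ge0// integral_ge0// => y _; exact: expeR_ge0.
have fine_Phi r :
    fine (Phi r) = expR (- (s r * N)) * cond_laplace K r (s r) * f r.
  by rewrite /Phi fineMr muleC fineMr [in RHS](mulrC (expR _)).
have mPhi : measurable_fun setT Phi.
  apply: emeasurable_funM; last exact/measurable_EFinP.
  apply: emeasurable_funM.
    apply/measurable_EFinP; apply: measurableT_comp => //.
    by apply: measurableT_comp => //; exact: measurable_funM.
  apply: (measurable_fun_integral_finite_kernel
    (fun z : R * \bar R => expeR (- ((s z.1)%:E * z.2))%E) K).
    by move=> z; exact: expeR_ge0.
  apply: (measurableT_comp (@measurable_expeR R)); apply: measurableT_comp => //.
  apply: emeasurable_funM => //.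
  by apply/measurable_EFinP; exact: measurableT_comp.
have intPhi : lebesgue_measure.-integrable D Phi.
  apply/integrableP; split; first exact: measurable_funTS.
  under eq_integral do rewrite gee0_abs//.
  rewrite -exponential_exceeds_probability.
  rewrite (le_lt_trans (probability_le1 P _)) ?ltry//.
  have mXYh : measurable_fun setT (fun w => ((X w, Y w), h w)).
    apply: measurable_fun_pair; last by case: h_exp.
    exact: measurable_fun_pair.
  rewrite -[X in measurable X]setTI.
  exact: mXYh measurableT _ measurable_U.
rewrite exponential_exceeds_probability /Rintegral; congr fine.
rewrite -/(Phi _).
apply: ae_eq_integral => //.
- exact: measurable_funTS.
- under eq_fun do rewrite -fine_Phi.
  apply/measurable_funTS/measurable_EFinP.
  by apply: (measurableT_comp (f := fine)) => //; exact: fine_measurable.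
- have := @integrable_ae _ (measurableTypeR R) _ _ _ mD _ intPhi.
  apply: filterS => r /[apply] Phi_fin.
  by rewrite -fine_Phi fineK.
Qed.

End coverage_formula.

(** * Measurability of countable sums and of counts *)

Section countable_families.
Context (d : measure_display) (T : measurableType d).

(** [esum] is a supremum of finite partial sums: it exceeds [r] exactly when one of them does, and
    the finite index sets are listed by the countably many sequences. *)
Lemma measurable_esum (R : realType) (I : countType) (a : I -> T -> \bar R) :
  (forall i, measurable_fun setT (a i)) ->
  measurable_fun setT (fun w => \esum_(i in setT) a i w)%E.
Proof.
move=> ma; apply: (measurability _ (ErealGenOInfty.measurableE R)).
move=> _ [_ [r ->] <-]; rewrite setTI.
rewrite (_ : _ @^-1` _ =
    \bigcup_(s : seq I) [set w | (r%:E < \sum_(i \in [set` s]) a i w)%E]).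
  apply: countable_bigcupT_measurable => [|s]; first exact: countableP.
  rewrite -[X in measurable X]setTI; apply: measurable_lte => //.
  exact: emeasurable_fsum (finite_seq s) ma.
apply/seteqP; split=> w /=; rewrite in_itv/= andbT.
  move=> /ereal_sup_gt[_ [A [/finite_seqP[s ->] _] <-] rA].
  by exists s.
case=> s _ /lt_le_trans; apply; apply: ereal_sup_ubound.
by exists [set` s] => //; split=> //; exact: finite_seq.
Qed.

(** The random index set has [n] elements exactly when it equals one of the countably many finite
    sets of cardinal [n]. Each such equality is a countable intersection, written as the complement
    of a union. *)
Lemma measurable_card_eq (I : countType) (A : I -> set T) (n : nat) :
  (forall i, measurable (A i)) ->
  measurable [set w | ([set i | A i w] #= `I_n)%card].
Proof.
move=> mA.
rewrite (_ : [set w | _] = \bigcup_(s : {fset I})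
    (if #|` s|%fset == n then ~` \bigcup_i (if i \in s then ~` A i else A i)
     else set0)).
  apply: countable_bigcupT_measurable => [|s]; first exact: countableP.
  case: ifP => // _.
  apply: measurableC; apply: countable_bigcupT_measurable => [|i]; first exact: countableP.
  by case: ifP => _ //; exact: measurableC.
apply/seteqP; split=> w /=.
  move=> Awn; have fA : finite_set [set i | A i w].
    by apply/finite_setP; exists n.
  exists (fset_set [set i | A i w]) => //.
  rewrite (card_fset_set Awn) eqxx => -[i _].
  by rewrite in_fset_set//; case: ifPn => [|]; rewrite ?notin_setE ?in_setE.
case=> s _; case: ifP => // /eqP sn nAw.
rewrite (_ : [set i | A i w] = [set` s]); first exact/card_eq_fsetP.
apply/seteqP; split=> i /= Ai.
  by apply/negPn/negP => si; apply: nAw; exists i; rewrite // (negbTE si).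
by apply: contrapT => nAi; apply: nAw; exists i; rewrite // Ai.
Qed.

End countable_families.

(** * Random points that may be absent *)

Section partial_points.
Context (d : measure_display) (T : measurableType d).
Context (dE : measure_display) (E : measurableType dE) (L : T -> option E).
Hypothesis mL : forall B, measurable B -> measurable (L @^-1` (Some @` B)).

Lemma measurable_isSome : measurable_fun setT (fun w => isSome (L w)).
Proof.
apply: (measurable_fun_bool true); rewrite setTI.
rewrite (_ : _ @^-1` _ = L @^-1` (Some @` setT)); first exact: mL.
by apply/seteqP; split=> w /=; case: (L w) => [x|] //; [exists x|case].
Qed.

(** An absent point is replaced by [x0], so the preimage of [B] gains the event of absence exactly
    when [x0] is in [B]. *)
Lemma measurable_odflt (x0 : E) : measurable_fun setT (fun w => odflt x0 (L w)).
Proof.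
move=> _ B mB; rewrite setTI.
have -> : (fun w => odflt x0 (L w)) @^-1` B = L @^-1` (Some @` B) `|`
    (if `[< B x0 >] then ~` (L @^-1` (Some @` setT)) else set0).
  apply/seteqP; split=> w /=; case Lw: (L w) => [x|] /=.
  - by move=> Bx; left; exists x.
  - by move=> /asboolT ->; right; rewrite /= Lw => -[].
  - case=> [[y By [<-]]//|]; case: ifP => // _; rewrite /= Lw.
    by case; exists x.
  - by case=> [[]//|]; case: asboolP.
apply: measurableU; first exact: mL.
by case: ifP => // _; apply: measurableC; exact: mL.
Qed.

End partial_points.

(** * Measurability of distances, path gain and interference *)

Section planar_measurability.
Context {R : realType} (q : system_params R).
Context (d : measure_display) (T : measurableType d).

Lemma measurable_norm2 : measurable_fun setT (@norm2 R).
Proof.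
apply: (@measurableT_comp _ _ _ _ _ _ (@Num.sqrt R)).
  by apply: continuous_measurable_fun; exact: sqrt_continuous.
by apply: measurable_funD; apply: measurable_funX.
Qed.

Lemma measurable_link_dist : measurable_fun setT (@link_dist R q).
Proof.
apply: (@measurableT_comp _ _ _ _ _ _ (@Num.sqrt R)).
  by apply: continuous_measurable_fun; exact: sqrt_continuous.
by apply: measurable_funD => //; exact: measurable_funX.
Qed.

Lemma measurable_path_gain : measurable_fun setT (@path_gain R q).
Proof.
apply: measurable_funM.
  apply: (measurableT_comp (measurable_powR _)); exact: measurable_link_dist.
apply: measurableT_comp => //; apply: measurable_funM => //.
exact: measurable_link_dist.
Qed.

Lemma measurable_interference (xk : T -> R * R) (U : uav_network R T)
    (rk : T -> R) :
  measurable_fun setT xk -> measurable_fun setT rk ->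
  (forall i B, measurable B -> measurable (in_region (uav_location U) i B)) ->
  (forall i, measurable_fun setT (uav_fading U i)) ->
  (forall i, measurable_fun setT (uav_gain U i)) ->
  (forall i, measurable_fun setT (uav_los U i)) ->
  measurable_fun setT (interference q xk U rk).
Proof.
move=> mxk mrk mloc mfad mgain mlos; apply: measurable_esum => i.
pose y w := odflt (0, 0) (uav_location U i w).
pose r w := norm2 (y w - xk w).
have my : measurable_fun setT y by apply: measurable_odflt; exact: mloc.
have mr : measurable_fun setT r.
  apply: (measurableT_comp measurable_norm2).
  apply: measurable_fun_pair; apply: measurable_funB.
  - exact: (measurableT_comp (f := fst)).
  - exact: (measurableT_comp (f := fst)).
  - exact: (measurableT_comp (f := snd)).
  - exact: (measurableT_comp (f := snd)).
(* With a default location guarded by the [isSome] test, each term becomes a composition of total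
   measurable functions. *)
rewrite (_ : (fun w => _) = fun w =>
  (if isSome (uav_location U i w) && (rk w < r w)%R then
   ((tx_power q * uav_gain U i w * uav_fading U i w * path_gain q (r w) *
    (if uav_los U i w then 1 else 0))%R)%:E else 0)%E); last first.
  apply/funext => w; rewrite /r /y; case: (uav_location U i w) => //= z.
  by case: (uav_los U i w).
apply: measurable_fun_ifT => //.
  apply: measurable_and.
    by apply: measurable_isSome; exact: mloc.
  exact: measurable_fun_ltr.
apply/measurable_EFinP; apply: measurable_funM; last exact: measurable_fun_ifT.
apply: measurable_funM; last exact: (measurableT_comp measurable_path_gain).
by apply: measurable_funM => //; apply: measurable_funM.
Qed.

End planar_measurability.

Lemma measurable_set_bool (d : measure_display) (T : measurableType d)
    (b : T -> bool) : measurable_fun setT b -> measurable [set x | b x].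
Proof.
by move=> mb; rewrite -[X in measurable X]setTI; exact: mb measurableT [set true] _.
Qed.

(** * The beam sector in Cartesian coordinates *)

Section sector.
Context {R : realType} (q : system_params R).

Lemma norm2_ge0 (x : R * R) : 0 <= norm2 x.
Proof. exact: sqrtr_ge0. Qed.

Lemma sqr_norm2 (x : R * R) : norm2 x ^+ 2 = x.1 ^+ 2 + x.2 ^+ 2.
Proof. by rewrite sqr_sqrtr// addr_ge0 ?sqr_ge0. Qed.

Lemma ler_cos : {in `[0, pi] &, {mono @cos R : x y /~ y <= x}}.
Proof.
by move=> x y x0 y0; rewrite leNgt ltr_cos// -leNgt.
Qed.

(** Cosine is even and decreasing on [[0, pi]], which contains half the beamwidth, so a bound on the
    absolute angle is a lower bound on its cosine. The resulting inequality has no quantifier over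
    angles and is visibly measurable. *)
Lemma in_sectorE (x : R * R) :
  in_sector q x <-> norm2 x * cos (beamwidth q / 2) <= x.1.
Proof.
have bw0 := beamwidth_gt0 q; have bwpi := beamwidth_ltpi q.
have bw_pi : beamwidth q / 2 \in `[0, pi] by rewrite in_itv/=; apply/andP; split; lra.
split=> [[t [tbw -> _]]|xbw].
  rewrite ler_wpM2l ?norm2_ge0//.
  have -> : cos t = cos `|t| by case: (ger0P t) => // _; rewrite cosN.
  by rewrite ler_cos// in_itv/= normr_ge0/=; lra.
(* The origin is treated apart, with angle 0, because [u] divides by the norm. *)
have [x0|x0] := eqVneq (norm2 x) 0.
  have := sqr_norm2 x; rewrite x0 expr0n/= => /esym/eqP.
  rewrite paddr_eq0 ?sqr_ge0// !sqrf_eq0 => /andP[/eqP x1 /eqP x2].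
  by exists 0; rewrite normr0 x1 x2 x0 !mul0r; split=> //; lra.
have {x0}n0 : 0 < norm2 x by rewrite lt0r x0 norm2_ge0.
pose u := x.1 / norm2 x.
have uE : x.1 = norm2 x * u by rewrite /u mulrC divfK// gt_eqF.
have vE : 1 - u ^+ 2 = (x.2 / norm2 x) ^+ 2.
  rewrite /u !expr_div_n sqr_norm2.
  have : x.1 ^+ 2 + x.2 ^+ 2 != 0 by rewrite -sqr_norm2 expf_neq0// gt_eqF.
  by move=> n0'; field.
have u1 : -1 <= u <= 1.
  have := sqr_ge0 (x.2 / norm2 x); rewrite -vE => u1.
  by apply/andP; split; nra.
have acosE : cos (acos u) = u by case: (acos_def u1).
have acos_bw : acos u <= beamwidth q / 2.
  rewrite -ler_cos//; first by rewrite acosE /u ler_pdivlMr// mulrC.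
  by rewrite in_itv/= acos_ge0// acos_lepi.
have sinE : norm2 x * sin (acos u) = `|x.2|.
  rewrite sin_acos// vE sqrtr_sqr normrM normfV (gtr0_norm n0) mulrC.
  by rewrite divfK// gt_eqF.
(* [acos] takes values in [[0, pi]], where sine is nonnegative; the sign of [x.2] selects the
   half-plane. *)
exists (if 0 <= x.2 then acos u else - acos u); case: ifPn => x2.
  by rewrite acosE sinE !ger0_norm ?acos_ge0.
rewrite cosN sinN mulrN acosE sinE normrN ger0_norm ?acos_ge0//.
by rewrite ltr0_norm ?opprK// ltNge.
Qed.

Lemma measurable_sector : measurable [set x | in_sector q x].
Proof.
rewrite (_ : [set x | _] = [set x | norm2 x * cos (beamwidth q / 2) <= x.1]).
  apply: measurable_set_bool; apply: measurable_fun_ler => //.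
  by apply: measurable_funM => //; exact: measurable_norm2.
by apply/seteqP; split=> x /in_sectorE.
Qed.

End sector.

(** * Uniqueness and measurability of the k-th nearest vehicle location *)

Section kth_nearest_vehicle.
Context {R : realType} (q : system_params R).
Context (d : measure_display) (T : measurableType d) (V : vehicle_network R T).

Lemma is_kth_nearest_unique (k : nat) (w : T) n m (x y : R * R) :
  (1 <= k)%N -> is_kth_nearest q V k w n x -> is_kth_nearest q V k w m y ->
  x = y.
Proof.
move=> k1.
(* Otherwise [k] vehicles are at least as close as the first one, hence strictly
   closer than the second one. *)
have lt_false n' m' x' y' : is_kth_nearest q V k w n' x' ->
    is_kth_nearest q V k w m' y' -> norm2 x' < norm2 y' -> False.
  move=> [_ _ cx] [_ cy _] xy.
  have /subset_card_le :
      [set m | exists2 y, sensed q V w m y & norm2 y <= norm2 x']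
      `<=` [set m | exists2 y, sensed q V w m y & norm2 y < norm2 y'].
    by move=> i [z sz zx]; exists z => //; exact: le_lt_trans zx xy.
  rewrite (card_le_eql cx) (card_le_eqr cy) card_le_II.
  (* The inclusion gives [k <= k.-1], absurd because [k] is positive; at [k = 0] the predecessor
     would be [k] itself. *)
  by case: (k) k1 => //= ? _; rewrite ltnn.
move=> kx ky.
have [xy|yx|xy] := ltgtP (norm2 x) (norm2 y).
- by case: (lt_false _ _ _ _ kx ky xy).
- by case: (lt_false _ _ _ _ ky kx yx).
case: kx => sx cx cx'; case: ky => sy cy _.
have [nm|nm] := eqVneq n m.
  by case: sx => [+ _ _]; case: sy => [+ _ _]; rewrite nm => -> [].
(* At equal distances, [n] and [m] both lie in [B] but not in [A], although the
   cardinals of [A] and [B] differ by one. *)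
exfalso; move: cx cx'; set A := [set _ | _] => cA; set B := [set _ | _] => cB.
have fA : finite_set A by apply/finite_setP; eexists; exact: cA.
have fB : finite_set B by apply/finite_setP; eexists; exact: cB.
have sub : (n |` (m |` fset_set A) `<=` fset_set B)%fset.
  apply/fsubsetP => i; rewrite (in_fset_set fB).
  move=> /fset1UP[->|/fset1UP[->|]]; last rewrite in_fset_set//; rewrite !in_setE.
  - by exists x.
  - by exists y; rewrite // xy.
  - by case=> z sz /ltW zx; exists z.
have := fsubset_leq_card sub.
have notA j z : sensed q V w j z -> norm2 z = norm2 x -> j \notin fset_set A.
  move=> [jz _ _] zx; rewrite in_fset_set//; apply/negP; rewrite in_setE.
  by case=> z' []; rewrite jz => -[<-] _ _; rewrite zx ltxx.
rewrite !cardfsU1 in_fset1U negb_or nm !(notA _ _ sx, notA _ _ sy)//=.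
rewrite (card_fset_set cA) (card_fset_set cB).
by case: (k) k1 => //= k' _; rewrite addnA addn1 ltnS ltnn.
Qed.

Hypothesis mroad : forall b i B, measurable B -> measurable (in_region (road V b) i B).
Hypothesis mtraffic : forall b i j B, measurable B ->
  measurable (in_region (traffic V b i) j B).
Hypothesis mdetectable : forall n, measurable_fun setT (detectable V n).

Lemma measurable_vehicle_location n B : measurable B ->
  measurable (vehicle_location V n @^-1` (Some @` B)).
Proof.
case: n => -[b i] j mB.
pose rd w := odflt 0 (road V b i w).
pose tr w := odflt 0 (traffic V b i j w).
have mrd : measurable_fun setT rd by apply: measurable_odflt; exact: mroad.
have mtr : measurable_fun setT tr by apply: measurable_odflt; exact: mtraffic.
rewrite (_ : _ @^-1` _ = in_region (road V b) i setT `&`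
    in_region (traffic V b i) j setT `&`
    (fun w => if b then (rd w, tr w) else (tr w, rd w)) @^-1` B).
  apply: measurableI; first by apply: measurableI; [exact: mroad|exact: mtraffic].
  rewrite -[X in measurable X]setTI.
  by case: b @rd @tr mrd mtr => rd tr mrd mtr; apply: measurable_fun_pair.
apply/seteqP; split=> w; rewrite /in_region /rd /tr /=;
  case: (road V b i w) => [rho|]; case: (traffic V b i j w) => [t|] //=.
- by move=> [x Bx [<-]]; split=> //; split; [exists rho|exists t].
- by case=> x.
- by case=> x.
- by case=> x.
- by move=> [_ Bx]; exists (if b then (rho, t) else (t, rho)).
- by case=> -[_ [? //]].
- by case=> -[[? //]].
- by case=> -[[? //]].
Qed.

Lemma measurable_sensed n B : measurable B ->
  measurable [set w | exists2 x, sensed q V w n x & B x].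
Proof.
move=> mB.
rewrite (_ : [set w | _] =
  (vehicle_location V n @^-1` (Some @` ([set x | in_sector q x] `&` B))) `&`
  [set w | detectable V n w]).
  apply: measurableI; last exact: measurable_set_bool.
  apply: measurable_vehicle_location; apply: measurableI => //.
  exact: measurable_sector.
apply/seteqP; split=> w /=.
  by move=> [x [nx det sec] Bx]; split=> //; exists x.
by move=> [[x [sec Bx] xn] det]; exists x.
Qed.

(** Once vehicle [n] is sensed, its location is determined by [n] and [w]. The distance in both
    counts is then the random variable [rho w n], and [measurable_card_eq] applies. *)
Lemma measurable_is_kth_nearest k n B : measurable B ->
  measurable [set w | exists2 x, is_kth_nearest q V k w n x & B x].
Proof.
move=> mB.
(* For an absent vehicle this is the norm of a default point; the counts below keep only sensed
   indices, so that value never enters. *)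
pose rho w m := norm2 (odflt (0, 0) (vehicle_location V m w)).
have mrho m : measurable_fun setT (rho^~ m).
  apply: (measurableT_comp measurable_norm2); apply: measurable_odflt.
  exact: measurable_vehicle_location.
have rhoE w m x : sensed q V w m x -> norm2 x = rho w m.
  by case=> mx _ _; rewrite /rho mx.
have msensed m : measurable [set w | exists x, sensed q V w m x].
  rewrite (_ : [set w | _] = [set w | exists2 x, sensed q V w m x & setT x]).
    exact: measurable_sensed.
  by apply/seteqP; split=> w [x]; exists x.
rewrite (_ : [set w | _] = [set w | exists2 x, sensed q V w n x & B x] `&`
  [set w | [set m | ([set w | exists x, sensed q V w m x] `&`
      [set w | rho w m < rho w n]) w] #= `I_k.-1] `&`
  [set w | [set m | ([set w | exists x, sensed q V w m x] `&`
      [set w | rho w m <= rho w n]) w] #= `I_k])%card.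
  apply: measurableI; first apply: measurableI.
  - exact: measurable_sensed.
  - apply: measurable_card_eq => m; apply: measurableI => //.
    by apply: measurable_set_bool; exact: measurable_fun_ltr.
  - apply: measurable_card_eq => m; apply: measurableI => //.
    by apply: measurable_set_bool; exact: measurable_fun_ler.
have ltE w x : sensed q V w n x ->
    [set m | exists2 y, sensed q V w m y & norm2 y < norm2 x] =
    [set m | ([set w | exists x, sensed q V w m x] `&`
      [set w | rho w m < rho w n]) w].
  move=> /rhoE ->; apply/seteqP; split=> m /=.
    by move=> [y sy]; rewrite (rhoE _ _ _ sy) => ?; split=> //; exists y.
  by move=> [[y sy] ?]; exists y; rewrite // (rhoE _ _ _ sy).
have leE w x : sensed q V w n x ->
    [set m | exists2 y, sensed q V w m y & norm2 y <= norm2 x] =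
    [set m | ([set w | exists x, sensed q V w m x] `&`
      [set w | rho w m <= rho w n]) w].
  move=> /rhoE ->; apply/seteqP; split=> m /=.
    by move=> [y sy]; rewrite (rhoE _ _ _ sy) => ?; split=> //; exists y.
  by move=> [[y sy] ?]; exists y; rewrite // (rhoE _ _ _ sy).
apply/seteqP; split=> w.
  move=> [x [sx clt cle] Bx]; split; first split.
  - by exists x.
  - by rewrite /= -(ltE _ _ sx).
  - by rewrite /= -(leE _ _ sx).
move=> [[[x sx Bx] /=]]; rewrite -(ltE _ _ sx) -(leE _ _ sx) => clt cle.
by exists x.
Qed.

(** By uniqueness the choice made by [xget] is forced. The preimage of [B] is a countable union over
    vehicle indices, together with the event that no k-th nearest vehicle exists when the default
    [(0, 0)] is in [B]. *)
Lemma measurable_kth_location k : (1 <= k)%N ->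
  measurable_fun setT (kth_location q V k).
Proof.
move=> k1 _ B mB; rewrite setTI.
pose K C := \bigcup_n [set w | exists2 x, is_kth_nearest q V k w n x & C x].
have mK C : measurable C -> measurable (K C).
  move=> mC; apply: countable_bigcupT_measurable => [|n]; first exact: countableP.
  exact: measurable_is_kth_nearest.
rewrite (_ : _ @^-1` _ = K B `|` (if `[< B (0, 0) >] then ~` K setT else set0)).
  apply: measurableU; first exact: mK.
  by case: ifP => // _; apply: measurableC; exact: mK.
apply/seteqP; split=> w; rewrite /kth_location /=.
  case: xgetP => [x _ [n nx] Bx|nox /asboolT ->].
    by left; exists n => //; exists x.
  by right=> -[n _ [x nx _]]; apply: (nox x); exists n.
case=> [[n _ [x nx Bx]]|].
  case: xgetP => [y _ [m my]|/(_ x)].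
    by rewrite (is_kth_nearest_unique _ _ _ _ _ _ k1 my nx).
  by case; exists n.
case: asboolP => // B0 noK; case: xgetP => [y _ [m my]|//].
by case: noK; exists m => //; exists y.
Qed.

End kth_nearest_vehicle.

(* The terms need not be nonnegative: [esum] is a supremum over finite subsets,
   one of which is empty. *)
Lemma interference_ge0 (R : realType) (dT : measure_display)
    (T : measurableType dT) (q : system_params R) (xk : T -> R * R)
    (U : uav_network R T) (rk : T -> R) (w : T) :
  (0 <= interference q xk U rk w)%E.
Proof.
apply: ereal_sup_ubound; exists set0; last by rewrite fsbig_set0.
by split; [exact: finite_set0|exact: sub0set].
Qed.

(** * The SINR event as a lower bound on the fading *)

Section sinr_threshold.
Context (R : realType) (q : system_params R) (tau : R).
Hypothesis tau_gt0 : 0 < tau.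

(** This is [tau] over the mean received power, as [fading_thresholdE] shows, kept in the form in
    which it enters the Laplace transform. *)
Definition fading_threshold (r : R) : R :=
  tau * link_dist q r `^ path_loss q * expR (absorption q * link_dist q r)
  / (tx_power q * main_gain q).

Let gain_gt0 : 0 < tx_power q * main_gain q.
Proof. by rewrite mulr_gt0// ?tx_power_gt0 ?main_gain_gt0. Qed.

Lemma link_dist_gt0 (r : R) : 0 < link_dist q r.
Proof.
by rewrite sqrtr_gt0 ltr_wpDl ?sqr_ge0// exprn_gt0// altitude_gt0.
Qed.

Lemma path_gain_gt0 (r : R) : 0 < path_gain q r.
Proof. by rewrite mulr_gt0 ?expR_gt0// powR_gt0// link_dist_gt0. Qed.

Lemma fading_thresholdE (r : R) :
  fading_threshold r = tau / (tx_power q * main_gain q * path_gain q r).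
Proof.
rewrite /fading_threshold /path_gain powRN mulNr expRN !invfM !invrK.
by rewrite !mulrA; ring.
Qed.

Lemma fading_threshold_gt0 (r : R) : 0 < fading_threshold r.
Proof. by rewrite fading_thresholdE divr_gt0// mulr_gt0// path_gain_gt0. Qed.

Lemma measurable_fading_threshold : measurable_fun setT fading_threshold.
Proof.
apply: measurable_funM => //; apply: measurable_funM.
  apply: measurable_funM => //; apply: (measurableT_comp (measurable_powR _)).
  exact: measurable_link_dist.
apply: measurableT_comp => //; apply: measurable_funM => //.
exact: measurable_link_dist.
Qed.

Lemma sinr_gt (r h : R) (y : \bar R) : (0 <= y)%E ->
  (tau%:E <
     (tx_power q * main_gain q * h * path_gain q r)%:E / (y + (noise q)%:E))%E =
  ((fading_threshold r)%:E * (y + (noise q)%:E) < h%:E)%E.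
Proof.
(* For infinite interference both sides are false: the quotient is 0, below [tau], and the threshold
   is infinite. For finite [y], the positive noise makes the denominator positive. *)
case: y => [y|_|//]; last first.
  rewrite addye// invey mule0 gt0_muley ?lte_fin ?fading_threshold_gt0//.
  by rewrite ltNge ltW.
rewrite lee_fin => y0; have n0 := noise_gt0 q.
have c0 : 0 < y + noise q by rewrite ltr_wpDl.
rewrite -EFinD inver gt_eqF// lte_pdivlMr// -!EFinM !lte_fin fading_thresholdE.
rewrite [in RHS]mulrAC ltr_pdivrMr; last by rewrite mulr_gt0// path_gain_gt0.
by congr (_ < _); ring.
Qed.

End sinr_threshold.

Theorem theorem5 (R : realType) (q : system_params R)
    (dT : measure_display) (T : measurableType dT) (P : probability T R)
    (V : vehicle_network R T) (U : uav_network R T) (ho : T -> R)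
    (k : nat) (rs tau : R) (f : R -> R)
    (K : R.-pker R ~> \bar R)
    (k_ge1 : (1 <= k)%N) (rs_gt0 : 0 < rs) (tau_gt0 : 0 < tau)
    (V_model : manhattan_cox_network q P V)
    (U_model : active_uav_network q P (kth_location q V k) U)
    (ho_exp : exponential_mean1 P ho)
    (ho_indep : independent2 P (sigma_rv ho)
       (sigma_rv (fun w => (kth_distance q V k w, kth_interference q V U k w))))
    (f_pdf : is_pdf P (kth_distance q V k) f)
    (K_law : is_conditional_law P (kth_distance q V k)
       (kth_interference q V U k) K) :
  coverage_prob q P V U ho k rs tau =
  (fine (P [set w | kth_distance q V k w <= rs]))^-1 *
  \int[lebesgue_measure]_(r in `[0, rs])
    (expR (- (tau * noise q * link_dist q r `^ path_loss q
              * expR (absorption q * link_dist q r)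
              / (tx_power q * main_gain q)))
     * cond_laplace K r (tau * link_dist q r `^ path_loss q
              * expR (absorption q * link_dist q r)
              / (tx_power q * main_gain q))
     * f r).
Proof.
have mloc : measurable_fun setT (kth_location q V k).
  apply: measurable_kth_location => //.
  - by move=> b; exact: ppp_measurable (roads_ppp V_model b).
  - by move=> b i; exact: ppp_measurable (traffic_ppp V_model b i).
  - by case: (detectable_marks V_model).
have mdist : measurable_fun setT (kth_distance q V k).
  exact: (measurableT_comp (measurable_norm2)).
have mint : measurable_fun setT (kth_interference q V U k).
  apply: measurable_interference => //.
  - exact: ppp_measurable (uav_ppp U_model).
  - by move=> i; case: (uav_fading_law U_model i).
  - exact: uav_gain_measurable U_model.
  - by case: (uav_los_marks U_model).
(* The inverse of the conditioning probability is a common factor, which leaves the joint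
   probability to compute. *)
rewrite /coverage_prob mulrC; congr (_ * _).
pose s := fading_threshold R q tau.
transitivity (fine (P [set w | ((s (kth_distance q V k w))%:E *
    (kth_interference q V U k w + (noise q)%:E) < (ho w)%:E)%E /\
    [set` `[0, rs]] (kth_distance q V k w)])).
  (* A distance is nonnegative, so being at most [rs] amounts to lying in the integration
     interval. *)
  congr (fine (P _)); apply/seteqP; split=> w /=;
    by rewrite /sinr sinr_gt ?interference_ge0// in_itv/= norm2_ge0.
rewrite (exponential_exceeds_Rintegral _ _ _ _ _ _ _ f s K) //.
- apply: eq_Rintegral => r _; rewrite /s /fading_threshold.
  by congr (expR _ * _ * _); ring.
- exact: measurable_fading_threshold.
- exact: ltW (noise_gt0 q).
- by move=> r; exact/ltW/fading_threshold_gt0.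
- by move=> w; exact: interference_ge0.
Qed.
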